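(* Let $P$ be a Poisson algebra over an arbitrary field. Then $P$ is Dedekind if and only if $\langle a\rangle_P$ is a Poisson ideal of $P$ for every $a\in P$.
   Context: A Poisson algebra over a field $F$ is an $F$-vector space $P$ with a bilinear commutative associative multiplication $xy$ (no identity element is assumed) and an alternating Lie bracket $[\,,\,]$ ($[x,x]=0$ for all $x$) satisfying $[xy,z]=x[y,z]+y[x,z]$. A Poisson subalgebra is a subspace closed under both operations (not required to contain an identity); a Poisson ideal is a subspace $I$ with $PI\subseteq I$ and $[P,I]\subseteq I$. A Poisson algebra is Dedekind if every Poisson subalgebra is a Poisson ideal. $\langle a\rangle_P$ denotes the Poisson subalgebra of $P$ generated by $a$. No finite-dimensionality is assumed. *)

(* Defs.v *)
From HB Require Import structures.
From mathcomp Require Import all_boot all_order all_algebra.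
From mathcomp Require Import sesquilinear.
From mathcomp Require Import boolp classical_sets.

Set Implicit Arguments.
Unset Strict Implicit.
Unset Printing Implicit Defensive.

Import GRing.Theory.

Local Open Scope ring_scope.
Local Open Scope classical_set_scope.

(* The product is a separate operation pmul rather than a ring structure from
   ssralg because no identity element is assumed. *)
HB.mixin Record Lmodule_isPoisson (F : fieldType) P of GRing.Lmodule F P := {
  pmul : P -> P -> P;
  pbrk : P -> P -> P;
  pmul_bilinear : bilinear_for *:%R *:%R pmul;
  pmulC : commutative pmul;
  pmulA : associative pmul;
  pbrk_bilinear : bilinear_for *:%R *:%R pbrk;
  pbrkxx : forall x, pbrk x x = 0;
  pbrk_jacobi : forall x y z,
    pbrk x (pbrk y z) + pbrk y (pbrk z x) + pbrk z (pbrk x y) = 0;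
  pbrkMl : forall x y z,
    pbrk (pmul x y) z = pmul x (pbrk y z) + pmul y (pbrk x z)
}.

#[short(type="poissonAlgType")]
HB.structure Definition PoissonAlgebra (F : fieldType) :=
  { P of GRing.Lmodule F P & Lmodule_isPoisson F P }.

Section PoissonSubspaces.
Variables (F : fieldType) (P : poissonAlgType F).
Implicit Types A I : set P.

Definition subspace A : Prop := submod_closed [in A].

Definition poisson_subalgebra A : Prop :=
  [/\ subspace A,
      forall x y, A x -> A y -> A (pmul x y)
    & forall x y, A x -> A y -> A (pbrk x y)].

Definition poisson_ideal I : Prop :=
  [/\ subspace I,
      forall p x, I x -> I (pmul p x)
    & forall p x, I x -> I (pbrk p x)].

Definition poisson_gen (a : P) : set P := smallest poisson_subalgebra [set a].

End PoissonSubspaces.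

Definition dedekind (F : fieldType) (P : poissonAlgType F) : Prop :=
  forall A : set P, poisson_subalgebra A -> poisson_ideal A.

(* Main.v *)
Require Import Defs.
From mathcomp Require Import all_boot all_order all_algebra.
From mathcomp Require Import boolp classical_sets.

(** Each absorption condition of an ideal involves one element [x] of it, and
    [poisson_gen x] lies in every subalgebra containing [x].  So if
    [poisson_gen x] absorbs products and brackets of [x] with arbitrary
    elements, then so does every subalgebra containing [x].  Conversely
    [poisson_gen a] is itself a subalgebra, being an intersection of
    subalgebras. *)

Lemma poisson_gen_id (F : fieldType) (P : poissonAlgType F) (a : P) :
  poisson_gen a a.
Proof. by move=> B [_]; apply. Qed.

Lemma poisson_gen_sub (F : fieldType) (P : poissonAlgType F) (A : set P)
    (a : P) :
  poisson_subalgebra A -> A a -> (poisson_gen a `<=` A)%classic.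
Proof. by move=> subA Aa; apply: smallest_sub => // _ ->. Qed.

Lemma poisson_gen_subalgebra (F : fieldType) (P : poissonAlgType F) (a : P) :
  poisson_subalgebra (poisson_gen a).
Proof.
split=> [|x y gx gy B|x y gx gy B].
- split=> [|c x y /set_mem gx /set_mem gy]; apply/mem_set=> B.
    by case=> -[[/set_mem B0 _] _ _].
  move=> BP; case: (BP) => -[[_ linB] _ _] _.
  by apply/set_mem/linB; apply/mem_set; [apply: gx | apply: gy].
- by move=> BP; case: (BP) => -[_ mulB _] _; apply: mulB; [apply: gx|apply: gy].
- by move=> BP; case: (BP) => -[_ _ brkB] _; apply: brkB; [apply: gx|apply: gy].
Qed.

Theorem lemma2p4 (F : fieldType) (P : poissonAlgType F) :
  dedekind P <-> (forall a : P, poisson_ideal (poisson_gen a)).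
Proof.
split=> [dedP a|genI A subA]; first exact/dedP/poisson_gen_subalgebra.
split=> [|p x Ax|p x Ax]; first by case: subA.
- have [_ mulI _] := genI x.
  exact: (poisson_gen_sub _ _ _ _ subA Ax) (mulI _ _ (poisson_gen_id _ _ x)).
- have [_ _ brkI] := genI x.
  exact: (poisson_gen_sub _ _ _ _ subA Ax) (brkI _ _ (poisson_gen_id _ _ x)).
Qed.
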